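(* Let $\mathbf v_{(-)}=(\rho,\vec v,T,\vec B,\psi)^T$ be the primitive-variable state at a solid-wall boundary node, with $\rho>0$, $T>0$, let $\vec n$ be the unit outward normal to the wall and $\vec B^0$ the prescribed external magnetic field at that node. Define the ghost (boundary) state, in primitive variables, by $$\mathbf v^a_{(+)}=\begin{bmatrix}\rho\\ \vec v-2(\vec v\cdot\vec n)\vec n\\ T\\ \vec B-2(\vec B\cdot\vec n-\vec B^0\cdot\vec n)\vec n\\ \psi\end{bmatrix}.$$ Then the advective flux penalty term, disregarding any contribution from the advective dissipation operator $\mathrm{DISS}^a$, is entropy-conservative at the boundary node; that is, the entropy production at the node by the advective numerical operator vanishes: $$\mathbf w_{(-)}^T\,\mathbf f^*(\mathbf u_{(-)},\mathbf u_{(+)})-\Psi^*_{(-)}=0 ,$$ where $\mathbf u_{(\pm)}$ are the conservative states corresponding to $\mathbf v_{(-)}$ and $\mathbf v^a_{(+)}$.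
   Context: The discretization is written in one space dimension ($x=x_1$; vectors have three components; all quantities depend on $x_1$ only); the wall normal is $\vec n=(1,0,0)$ at a right boundary and $\vec n=(-1,0,0)$ at a left boundary, and $B^0_1$ is the first component of $\vec B^0$. Conservative state: $\mathbf u=(\rho,\rho\vec v,E,\vec B,\psi)^T$. Perfect gas: $p=\rho RT=(\gamma-1)(E-\frac12\rho\|\vec v\|^2-\frac1{2\mu_0}\|\vec B\|^2-\frac1{2\mu_0}\psi^2)$. Entropy: $S=-\rho s$, $s=\frac R{\gamma-1}\ln(T/T^* )-R\ln(\rho/\rho^* )$ ($T^*,\rho^*$ reference constants); entropy variables $\mathbf w^T=\left(\frac{\gamma R}{\gamma-1}-s-\frac{\|\vec v\|^2}{2T},\frac{\vec v}T,-\frac1T,\frac{\vec B}{\mu_0T},\frac\psi{\mu_0T}\right)$; entropy flux in the $x$ direction $f^S=Sv_1$. Two-point flux. For two states $\mathbf u_i,\mathbf u_j$, $$\mathbf f^*(\mathbf u_i,\mathbf u_j)=\mathbf f^{EC}(\mathbf u_i,\mathbf u_j)+\tfrac12\left(\boldsymbol\phi^{MHD}_iB_{1,j}+\boldsymbol\phi^{GLM}_i\psi_j\right),$$ with $\boldsymbol\phi^{MHD}=(0,\vec B/\mu_0,\vec v\cdot\vec B/\mu_0,\vec v,0)^T$ and $\boldsymbol\phi^{GLM}=(0,\vec0,v_1\psi/\mu_0,\vec0,v_1)^T$. The symmetric flux $\mathbf f^{EC}$ is, with $\{\!\{a\}\!\}=\frac12(a_i+a_j)$, $a^{\ln}=(a_j-a_i)/(\ln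 a_j-\ln a_i)$ (equal to $a$ if $a_i=a_j=a$), $\beta=\rho/p$, $\overline p=\{\!\{\rho\}\!\}/\{\!\{\beta\}\!\}$: $f_1=\rho^{\ln}\{\!\{v_1\}\!\}$; $f_2=\rho^{\ln}\{\!\{v_1\}\!\}^2+\overline p+\frac1{2\mu_0}(\{\!\{B_1^2\}\!\}+\{\!\{B_2^2\}\!\}+\{\!\{B_3^2\}\!\})-\frac1{\mu_0}\{\!\{B_1\}\!\}^2$; $f_3=\rho^{\ln}\{\!\{v_1\}\!\}\{\!\{v_2\}\!\}-\frac1{\mu_0}\{\!\{B_1\}\!\}\{\!\{B_2\}\!\}$; $f_4=\rho^{\ln}\{\!\{v_1\}\!\}\{\!\{v_3\}\!\}-\frac1{\mu_0}\{\!\{B_1\}\!\}\{\!\{B_3\}\!\}$; $f_6=c_h\{\!\{\psi\}\!\}$; $f_7=\{\!\{v_1\}\!\}\{\!\{B_2\}\!\}-\{\!\{v_2\}\!\}\{\!\{B_1\}\!\}$; $f_8=\{\!\{v_1\}\!\}\{\!\{B_3\}\!\}-\{\!\{v_3\}\!\}\{\!\{B_1\}\!\}$; $f_9=c_h\{\!\{B_1\}\!\}$; $$\begin{aligned}f_5=&f_1\Big[\tfrac1{(\gamma-1)\beta^{\ln}}-\tfrac12(\{\!\{v_1^2\}\!\}+\{\!\{v_2^2\}\!\}+\{\!\{v_3^2\}\!\})\Big]+f_2\{\!\{v_1\}\!\}+f_3\{\!\{v_2\}\!\}+f_4\{\!\{v_3\}\!\}\\&+\tfrac1{\mu_0}\Big[f_6\{\!\{B_1\}\!\}+f_7\{\!\{B_2\}\!\}+f_8\{\!\{B_3\}\!\}-\tfrac12(\{\!\{v_1B_1^2\}\!\}+\{\!\{v_1B_2^2\}\!\}+\{\!\{v_1B_3^2\}\!\})\\&\quad+(\{\!\{v_1B_1\}\!\}+\{\!\{v_2B_2\}\!\}+\{\!\{v_3B_3\}\!\})\{\!\{B_1\}\!\}+f_9\{\!\{\psi\}\!\}-c_h\{\!\{B_1\psi\}\!\}\Big].\end{aligned}$$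 The entropy potential at a node $k$ is $\Psi^*_k=\mathbf w_k^T\mathbf f^*(\mathbf u_k,\mathbf u_k)-f^S_k$. Entropy production. In the semi-discrete entropy balance of a DG-SBP-SAT element (nodes $0,\dots,N$), the non-dissipative advective contribution of the interface/boundary penalty is $-(\mathbf w_N^T\mathbf f^*(\mathbf u_N,\mathbf u_R)-\Psi^*_N)$ at the right end node and $+(\mathbf w_0^T\mathbf f^*(\mathbf u_0,\mathbf u_L)-\Psi^*_0)$ at the left end node, where $R,L$ denote the neighbouring (here ghost) states. Entropy-conservative means that this contribution is zero. *)

(* Defs.v *)
From HB Require Import structures.
From mathcomp Require Import all_boot all_order all_algebra.
From mathcomp Require Import reals exp.

Set Implicit Arguments.
Unset Strict Implicit.
Unset Printing Implicit Defensive.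

Import Order.TTheory GRing.Theory Num.Theory.
Local Open Scope ring_scope.

(* The norm `|x| of the library is the sup norm on row vectors, so the
   Euclidean square is written dot x x. *)
Definition dot (R : realType) (n : nat) (x y : 'rV[R]_n) : R :=
  \sum_(k < n) x 0 k * y 0 k.

(* gamma_gas: adiabatic exponent; R_gas: specific gas constant; mu0: magnetic
   permeability; c_h: divergence-cleaning speed; T_ref, rho_ref: the reference
   constants T^*, rho^* of the entropy. *)
Record mhd_params (R : realType) := MhdParams {
  gamma_gas : R; R_gas : R; mu0 : R; c_h : R; T_ref : R; rho_ref : R }.

(* Vectors of R^9 are indexed from 0, so component k.+1 of the literature is
   the entry of index k: density 0, momentum 1-3, energy 4, magnetic field 5-7,
   psi 8. *)
Definition blocks (R : realType)
    (a : R) (x : 'rV[R]_3) (b : R) (y : 'rV[R]_3) (c : R) : 'rV[R]_9 :=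
  \row_(i < 9) nth 0 [:: a; x 0 0; x 0 1; x 0 2; b;
                         y 0 0; y 0 1; y 0 2; c] i.

Section Variables_of_a_state.
Context (R : realType) (P : mhd_params R).
Implicit Types u : 'rV[R]_9.

Definition density u : R := u 0 0.
Definition momentum u : 'rV[R]_3 := \row_(k < 3) u 0 (inord (1 + k)).
Definition energy u : R := u 0 4.
Definition magnetic u : 'rV[R]_3 := \row_(k < 3) u 0 (inord (5 + k)).
Definition glm_psi u : R := u 0 8.

Definition velocity u : 'rV[R]_3 := (density u)^-1 *: momentum u.

Definition pressure u : R :=
  (gamma_gas P - 1) *
  (energy u - 2^-1 * density u * dot (velocity u) (velocity u)
   - (2 * mu0 P)^-1 * dot (magnetic u) (magnetic u)
   - (2 * mu0 P)^-1 * glm_psi u ^+ 2).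

(* from p = rho R T *)
Definition temperature u : R := pressure u / (density u * R_gas P).

Definition beta u : R := density u / pressure u.

Definition spec_entropy u : R :=
  R_gas P / (gamma_gas P - 1) * ln (temperature u / T_ref P)
  - R_gas P * ln (density u / rho_ref P).

Definition entropy u : R := - (density u * spec_entropy u).

Definition entropy_flux u : R := entropy u * velocity u 0 0.

Definition entropy_vars u : 'rV[R]_9 :=
  let T := temperature u in
  let v := velocity u in
  blocks (gamma_gas P * R_gas P / (gamma_gas P - 1) - spec_entropy u
            - dot v v / (2 * T))
         (T^-1 *: v)
         (- T^-1)
         ((mu0 P * T)^-1 *: magnetic u)
         (glm_psi u / (mu0 P * T)).

Definition phi_MHD u : 'rV[R]_9 :=
  blocks 0 ((mu0 P)^-1 *: magnetic u)
         (dot (velocity u) (magnetic u) / mu0 P) (velocity u) 0.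

Definition phi_GLM u : 'rV[R]_9 :=
  blocks 0 0 (velocity u 0 0 * glm_psi u / mu0 P) 0 (velocity u 0 0).

End Variables_of_a_state.

Definition log_mean (R : realType) (a b : R) : R :=
  if a == b then a else (b - a) / (ln b - ln a).

Definition flux_EC (R : realType) (P : mhd_params R) (ui uj : 'rV[R]_9)
  : 'rV[R]_9 :=
  let av (a : 'rV[R]_9 -> R) := (a ui + a uj) / 2 in
  let lnav (a : 'rV[R]_9 -> R) := log_mean (a ui) (a uj) in
  let rho := @density R in
  let beta := beta P in
  let psi := @glm_psi R in
  let v1 u := velocity u 0 0 in
  let v2 u := velocity u 0 1 in
  let v3 u := velocity u 0 2 in
  let B1 u := magnetic u 0 0 in
  let B2 u := magnetic u 0 1 in
  let B3 u := magnetic u 0 2 in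
  let mu := mu0 P in
  let ch := c_h P in
  let pbar := av rho / av beta in
  let f1 := lnav rho * av v1 in
  let f2 := lnav rho * av v1 ^+ 2 + pbar
    + (2 * mu)^-1 * (av (fun u => B1 u ^+ 2) + av (fun u => B2 u ^+ 2)
                     + av (fun u => B3 u ^+ 2))
    - mu^-1 * av B1 ^+ 2 in
  let f3 := lnav rho * av v1 * av v2 - mu^-1 * (av B1 * av B2) in
  let f4 := lnav rho * av v1 * av v3 - mu^-1 * (av B1 * av B3) in
  let f6 := ch * av psi in
  let f7 := av v1 * av B2 - av v2 * av B1 in
  let f8 := av v1 * av B3 - av v3 * av B1 in
  let f9 := ch * av B1 in
  let f5 :=
    f1 * (((gamma_gas P - 1) * lnav beta)^-1
          - 2^-1 * (av (fun u => v1 u ^+ 2) + av (fun u => v2 u ^+ 2)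
                    + av (fun u => v3 u ^+ 2)))
    + f2 * av v1 + f3 * av v2 + f4 * av v3
    + mu^-1 *
      (f6 * av B1 + f7 * av B2 + f8 * av B3
       - 2^-1 * (av (fun u => v1 u * B1 u ^+ 2)
                 + av (fun u => v1 u * B2 u ^+ 2)
                 + av (fun u => v1 u * B3 u ^+ 2))
       + (av (fun u => v1 u * B1 u) + av (fun u => v2 u * B2 u)
          + av (fun u => v3 u * B3 u)) * av B1
       + f9 * av psi - ch * av (fun u => B1 u * psi u)) in
  \row_(i < 9) nth 0 [:: f1; f2; f3; f4; f5; f6; f7; f8; f9] i.

(* Not symmetric in (ui, uj): the first state is the local one. *)
Definition flux_star (R : realType) (P : mhd_params R) (ui uj : 'rV[R]_9)
  : 'rV[R]_9 :=
  flux_EC P ui uj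
  + 2^-1 *: (magnetic uj 0 0 *: phi_MHD P ui + glm_psi uj *: phi_GLM P ui).

Definition entropy_potential (R : realType) (P : mhd_params R) (u : 'rV[R]_9)
  : R :=
  dot (entropy_vars P u) (flux_star P u u) - entropy_flux P u.

Record prim_state (R : realType) := PrimState {
  p_rho : R; p_vel : 'rV[R]_3; p_temp : R; p_mag : 'rV[R]_3; p_psi : R }.

(* The energy is the equation of state p = rho R T = (gamma-1)(E - ...) solved
   for E. *)
Definition conservative (R : realType) (P : mhd_params R) (q : prim_state R)
  : 'rV[R]_9 :=
  blocks (p_rho q)
    (p_rho q *: p_vel q)
    (p_rho q * R_gas P * p_temp q / (gamma_gas P - 1)
     + 2^-1 * p_rho q * dot (p_vel q) (p_vel q)
     + (2 * mu0 P)^-1 * dot (p_mag q) (p_mag q)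
     + (2 * mu0 P)^-1 * p_psi q ^+ 2)
    (p_mag q)
    (p_psi q).

Definition wall_ghost (R : realType) (n B0 : 'rV[R]_3) (q : prim_state R)
  : prim_state R :=
  PrimState (p_rho q)
    (p_vel q - (2 * dot (p_vel q) n) *: n)
    (p_temp q)
    (p_mag q - (2 * (dot (p_mag q) n - dot B0 n)) *: n)
    (p_psi q).

Inductive boundary_side := LeftBoundary | RightBoundary.

Definition outward_normal (R : realType) (side : boundary_side) : 'rV[R]_3 :=
  match side with
  | RightBoundary => delta_mx 0 0
  | LeftBoundary => - delta_mx 0 0
  end.

(* Non-dissipative advective contribution of the boundary penalty to the
   semi-discrete entropy balance: the end node carries state u, the neighbour
   is u'.  The flux is always the one in the +x direction, hence the sign. *)
Definition entropy_production (R : realType) (P : mhd_params R)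
    (side : boundary_side) (u u' : 'rV[R]_9) : R :=
  let r := dot (entropy_vars P u) (flux_star P u u') - entropy_potential P u in
  match side with
  | RightBoundary => - r
  | LeftBoundary => r
  end.

Definition entropy_conservative (R : realType) (P : mhd_params R)
    (side : boundary_side) (u u' : 'rV[R]_9) : Prop :=
  entropy_production P side u u' = 0.

(* Main.v *)
(* The ghost state has the density, temperature, tangential fields and psi of
   the node and the opposite normal velocity.  Hence the logarithmic means
   collapse to nodal values, and the mean normal velocity, and with it the mass
   flux, vanishes; this removes the logarithms of w from the balance on one
   side, and on the other they cancel against the entropy flux.  What remains
   is a rational identity in which the ghost normal magnetic field cancels
   between the symmetric flux and the nonconservative terms. *)

Require Import Defs.
From mathcomp Require Import all_boot all_order all_algebra.
From mathcomp Require Import reals exp.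
From mathcomp Require Import ring.

Import Order.TTheory GRing.Theory Num.Theory.
Local Open Scope ring_scope.

Lemma dot3E (R : realType) (x y : 'rV[R]_3) :
  dot x y = x 0 0 * y 0 0 + x 0 1 * y 0 1 + x 0 2 * y 0 2.
Proof.
rewrite /dot !big_ord_recl big_ord0 addr0 !addrA.
by do ![congr (_ + _)]; congr (_ * _); congr (_ 0 _); apply/val_inj.
Qed.

(** [blocks] and [flux_EC] both unfold to rows of this [nth] form, so their pairings become explicit
    sums within reach of [field]. *)
Lemma dot9_nth (R : realType) (s t : seq R) :
  dot (\row_(i < 9) nth 0 s i) (\row_(i < 9) nth 0 t i) =
  s`_0 * t`_0 + s`_1 * t`_1 + s`_2 * t`_2 + s`_3 * t`_3 + s`_4 * t`_4
  + s`_5 * t`_5 + s`_6 * t`_6 + s`_7 * t`_7 + s`_8 * t`_8.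
Proof. by rewrite /dot !big_ord_recl big_ord0 addr0 !addrA !mxE. Qed.

Lemma dotDr (R : realType) (m : nat) (x y z : 'rV[R]_m) :
  dot x (y + z) = dot x y + dot x z.
Proof.
by rewrite /dot -big_split; apply: eq_bigr => k _; rewrite mxE mulrDr.
Qed.

Lemma dotZr (R : realType) (m : nat) (a : R) (x y : 'rV[R]_m) :
  dot x (a *: y) = a * dot x y.
Proof.
by rewrite /dot mulr_sumr; apply: eq_bigr => k _; rewrite mxE mulrCA.
Qed.

Lemma row3P (R : realType) (x y : 'rV[R]_3) :
  x 0 0 = y 0 0 -> x 0 1 = y 0 1 -> x 0 2 = y 0 2 -> x = y.
Proof.
move=> e0 e1 e2; apply/rowP => -[[|[|[|//]]] lti].
- by rewrite (_ : Ordinal lti = 0) //; apply/val_inj.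
- by rewrite (_ : Ordinal lti = 1) //; apply/val_inj.
- by rewrite (_ : Ordinal lti = 2) //; apply/val_inj.
Qed.

Section Conservative_variables.
Context (R : realType) (P : mhd_params R).
Implicit Types q : prim_state R.

Lemma density_conservative q : density (conservative P q) = p_rho q.
Proof. by rewrite /density mxE. Qed.

Lemma glm_psi_conservative q : glm_psi (conservative P q) = p_psi q.
Proof. by rewrite /glm_psi mxE. Qed.

Lemma magnetic_conservative q : magnetic (conservative P q) = p_mag q.
Proof. by apply: row3P; rewrite !mxE inordK. Qed.

Lemma velocity_conservative q :
  p_rho q != 0 -> velocity (conservative P q) = p_vel q.
Proof.
move=> rho0; rewrite /velocity density_conservative.
by apply: row3P; rewrite !mxE inordK //= mulKf.
Qed.

Lemma pressure_conservative q : p_rho q != 0 -> gamma_gas P - 1 != 0 ->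
  pressure P (conservative P q) = p_rho q * R_gas P * p_temp q.
Proof.
move=> rho0 g0; rewrite /pressure velocity_conservative //.
rewrite density_conservative magnetic_conservative glm_psi_conservative.
rewrite /energy mxE /=.
(* The kinetic, magnetic and [psi] energies cancel as atoms; abstracting them keeps the inverse of
   [mu0 P] away from [field]. *)
set e1 := _ * dot _ _; set e2 := _ * dot _ _; set e3 := _ * _ ^+ 2.
by field.
Qed.

Lemma temperature_conservative q :
    p_rho q != 0 -> gamma_gas P - 1 != 0 -> R_gas P != 0 ->
  temperature P (conservative P q) = p_temp q.
Proof.
move=> rho0 g0 R0; rewrite /temperature pressure_conservative //.
by rewrite density_conservative mulrC mulKf // mulf_neq0.
Qed.

End Conservative_variables.

Section Wall_ghost.
Context (R : realType) (side : boundary_side) (B0 : 'rV[R]_3).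
Implicit Types q : prim_state R.
Local Notation ghost q := (wall_ghost (outward_normal R side) B0 q).

(** The reflection is even in the normal, so both sides give the same ghost velocity. *)
Lemma wall_ghost_vel q :
  [/\ p_vel (ghost q) 0 0 = - p_vel q 0 0,
      p_vel (ghost q) 0 1 = p_vel q 0 1 &
      p_vel (ghost q) 0 2 = p_vel q 0 2].
Proof. by case: side; rewrite /= dot3E !mxE /=; split; ring. Qed.

(** Again even in the normal; the nodal and ghost normal components average to [B0 0 0]. *)
Lemma wall_ghost_mag q :
  [/\ p_mag (ghost q) 0 0 = 2 * B0 0 0 - p_mag q 0 0,
      p_mag (ghost q) 0 1 = p_mag q 0 1 &
      p_mag (ghost q) 0 2 = p_mag q 0 2].
Proof. by case: side; rewrite /= !dot3E !mxE /=; split; ring. Qed.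

End Wall_ghost.

Lemma log_mean_id (R : realType) (a : R) : log_mean a a = a.
Proof. by rewrite /log_mean eqxx. Qed.

Lemma dot_entropy_vars_wall_ghost (R : realType) (P : mhd_params R)
    (side : boundary_side) (B0 : 'rV[R]_3) (q : prim_state R) :
    gamma_gas P - 1 != 0 -> R_gas P != 0 -> mu0 P != 0 ->
    p_rho q != 0 -> p_temp q != 0 ->
  let u := conservative P q in
  dot (entropy_vars P u)
      (flux_star P u
         (conservative P (wall_ghost (outward_normal R side) B0 q)))
  = entropy_potential P u.
Proof.
move=> g0 R0 mu_neq0 rho0 temp0 u; rewrite /entropy_potential /flux_star.
(* Splitting by linearity before unfolding leaves only pairings of two literal rows. *)
rewrite !dotDr !dotZr !dotDr !dotZr /flux_EC /entropy_vars.
rewrite /phi_MHD /phi_GLM /blocks !dot9_nth /=.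
(* [spec_entropy] stays folded: its logarithms enter the final identity as a single atom. *)
rewrite /entropy_flux /entropy !dot3E /beta /u.
rewrite !temperature_conservative ?pressure_conservative //.
rewrite !velocity_conservative // !magnetic_conservative.
rewrite !density_conservative !glm_psi_conservative.
case: (@wall_ghost_vel R side B0 q) => -> -> ->.
case: (@wall_ghost_mag R side B0 q) => -> -> ->.
(* Density and temperature of the ghost reduce to those of the node, so both arguments of each
   logarithmic mean are convertible. *)
rewrite !log_mean_id !mxE.
by field; rewrite temp0 mu_neq0 g0 R0.
Qed.

Theorem theorem3 (R : realType) (P : mhd_params R)
    (gamma_gt1 : 1 < gamma_gas P) (R_gas_gt0 : 0 < R_gas P)
    (mu0_gt0 : 0 < mu0 P) (T_ref_gt0 : 0 < T_ref P)
    (rho_ref_gt0 : 0 < rho_ref P)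
    (side : boundary_side) (B0 : 'rV[R]_3) (vm : prim_state R)
    (rho_gt0 : 0 < p_rho vm) (T_gt0 : 0 < p_temp vm) :
  let n := outward_normal R side in
  let vp := wall_ghost n B0 vm in
  let um := conservative P vm in
  let up := conservative P vp in
  entropy_conservative P side um up /\
  dot (entropy_vars P um) (flux_star P um up) - entropy_potential P um = 0.
Proof.
move=> n vp um up.
(* The production is this balance up to a sign fixed by the side, so one identity yields both
   conjuncts. *)
have balance : dot (entropy_vars P um) (flux_star P um up)
               - entropy_potential P um = 0.
  apply/eqP; rewrite subr_eq0; apply/eqP/dot_entropy_vars_wall_ghost;
  by rewrite ?lt0r_neq0 ?subr_gt0.
split=> //; rewrite /entropy_conservative /entropy_production balance.
by case: (side); rewrite ?oppr0.
Qed.
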